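(* Let $\mathscr{A}$ be a $C^*$-algebra with unit $e$ and let $a\in\mathscr{A}$. For any $\alpha\in\mathbb{C}\setminus\{0\}$, $$v^3(a)\leq\frac{1}{|\alpha|}\left(\max\{1,|\alpha-1|\}\,\|a\|^3+\min\{v(a^*a^2),v(a^2a^* )\}\right).$$
   Context: $\mathcal{S}(\mathscr{A})$ is the state space of $\mathscr{A}$, i.e. the set of positive linear functionals $\varphi$ on $\mathscr{A}$ with $\varphi(e)=1$. The numerical radius of $a\in\mathscr{A}$ is $v(a)=\sup\{|\varphi(a)|:\varphi\in\mathcal{S}(\mathscr{A})\}$, and $v^k(a)$ means $(v(a))^k$. $\|\cdot\|$ is the $C^*$-norm. *)

(* Defs.v *)
From HB Require Import structures.
From mathcomp Require Import all_boot all_order all_algebra.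
From mathcomp Require Import complex.
From mathcomp Require Import boolp classical_sets reals topology normedtype.

Set Implicit Arguments.
Unset Strict Implicit.
Unset Printing Implicit Defensive.

Import Order.TTheory GRing.Theory Num.Theory.
Import numFieldNormedType.Exports.

Local Open Scope classical_set_scope.
Local Open Scope ring_scope.

(* A C^*-algebra with unit, bundled over its underlying Banach space. The ring
   operations are given as fields because HB refuses a structure joining
   normed modules and rings (it would have to precede Num.NumDomain); they are
   turned into a GRing.Algebra instance on the carrier below. *)
Record cstarAlgType (K : numClosedFieldType) := CStarAlgType {
  cstar_base : completeNormedModType K;
  cstar_one : cstar_base;
  cstar_mul : cstar_base -> cstar_base -> cstar_base;
  cstar_star : cstar_base -> cstar_base;
  cstar_mulA : associative cstar_mul;
  cstar_mul1l : left_id cstar_one cstar_mul;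
  cstar_mulr1 : right_id cstar_one cstar_mul;
  cstar_mulDl : left_distributive cstar_mul +%R;
  cstar_mulDr : right_distributive cstar_mul +%R;
  cstar_scaleAl : forall (c : K) (x y : cstar_base),
    c *: cstar_mul x y = cstar_mul (c *: x) y;
  cstar_scaleAr : forall (c : K) (x y : cstar_base),
    c *: cstar_mul x y = cstar_mul x (c *: y);
  cstar_oner_neq0 : cstar_one != 0;
  cstar_starD : {morph cstar_star : x y / x + y};
  cstar_starZ : forall (c : K) (x : cstar_base),
    cstar_star (c *: x) = c^* *: cstar_star x;
  cstar_starM : forall x y : cstar_base,
    cstar_star (cstar_mul x y) = cstar_mul (cstar_star y) (cstar_star x);
  cstar_starK : involutive cstar_star;
  cstar_normM : forall x y : cstar_base, `|cstar_mul x y| <= `|x| * `|y|;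
  cstar_norm_starM : forall x : cstar_base,
    `|cstar_mul (cstar_star x) x| = `|x| ^+ 2
}.

Definition cstar_sort (K : numClosedFieldType) (A : cstarAlgType K) : Type :=
  cstar_base A.
Coercion cstar_sort : cstarAlgType >-> Sortclass.

Section cstar_instances.
Context {K : numClosedFieldType} (A : cstarAlgType K).

HB.instance Definition _ :=
  CompleteNormedModule.copy (cstar_sort A) (cstar_base A).

HB.instance Definition _ := GRing.Zmodule_isNzRing.Build (cstar_sort A)
  (@cstar_mulA K A) (@cstar_mul1l K A) (@cstar_mulr1 K A)
  (@cstar_mulDl K A) (@cstar_mulDr K A) (@cstar_oner_neq0 K A).

HB.instance Definition _ := GRing.Lmodule_isLalgebra.Build K (cstar_sort A)
  (@cstar_scaleAl K A).

HB.instance Definition _ := GRing.Lalgebra_isAlgebra.Build K (cstar_sort A)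
  (@cstar_scaleAr K A).

Definition star (x : A) : A := cstar_star x.

End cstar_instances.

Section states.
Context {R : realType} {A : cstarAlgType R[i]}.

(* [0 <= z] in [R[i]] means that z is a nonnegative real number. *)
Definition positive_functional (phi : {scalar A}) : Prop :=
  forall x : A, 0 <= phi (star x * x).

Definition state_space : set {scalar A} :=
  [set phi | positive_functional phi /\ phi 1 = 1].

(* The library norm of A takes its values in the scalars R[i]; it is a
   nonnegative real there, so taking the real part loses nothing. *)
Definition cstar_norm (a : A) : R := complex.Re `|a|.

(* The set below is nonempty and bounded (by [cstar_norm a]), so [sup], which
   the library totalizes by 0, is the genuine supremum. *)
Definition numerical_radius (a : A) : R :=
  sup [set ComplexField.Normc.normc (phi a) | phi in state_space].

End states.

(* Main.v *)
Require Import Defs.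
From mathcomp Require Import all_boot all_order all_algebra.
From mathcomp Require Import complex.
From mathcomp Require Import boolp classical_sets reals topology normedtype.
From mathcomp Require Import sequences exp.
From mathcomp Require Import ring.

(** Fix a state [phi]. The form [<x, y> = phi (star y * x)] is a semi-inner
product for which the unit has length 1, and a positive functional satisfies
[|phi x|^2 <= phi (star x * x)] by the Cauchy-Schwarz inequality
([state_sqr_le]). A Buzano-type inequality holds for this form,
[[
  |alpha| |<x, e>| |<e, y>| <= max(1, |alpha - 1|) |x| |y| + |<x, y>|,
]]
because [alpha <x, e> e - x] has length at most [max(1, |alpha - 1|) |x|]
([state_buzano]). Taking [x = a] and [y = star a * a] makes the left side
[|alpha| |phi a| phi (star a * a) >= |alpha| |phi a|^3], while [<x, y>] is
[phi (star a * a^2)]; taking [x = a * star a] and [y = star a] gives the same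
bound with [phi (a^2 * star a)]. Both right-hand sides are at most
[max(1, |alpha - 1|) |a|^3] plus a numerical radius, and the supremum over
[phi] concludes.

The lengths in the semi-inner product are compared with the norm of the
algebra through [phi (star x * x) <= |x|^2] ([state_le_sqr_norm]). As
positivity of [phi] is only assumed on elements [star y * y], this needs
[1 - h] to be of that form for self-adjoint [h] with [|h| < 1]
([one_sub_square]): a self-adjoint square root of [1 - h] is [1 - l], where [l] is the
limit of the contracting iteration [u <- (h + u^2) / 2]. *)

Import Order.TTheory GRing.Theory Num.Theory.
Import numFieldNormedType.Exports.
Local Open Scope ring_scope.

(** * The involution *)

Section involution.
Context {K : numClosedFieldType} {A : cstarAlgType K}.
Implicit Types (x y : A) (c : K).

Lemma starD x y : star (x + y) = star x + star y.
Proof. exact: cstar_starD. Qed.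

Lemma starZ c x : star (c *: x) = c^* *: star x.
Proof. exact: cstar_starZ. Qed.

Lemma starM x y : star (x * y) = star y * star x.
Proof. exact: cstar_starM. Qed.

Lemma starK x : star (star x) = x.
Proof. exact: cstar_starK. Qed.

Lemma star0 : star (0 : A) = 0.
Proof. by apply: (addIr (star 0)); rewrite -starD !add0r. Qed.

Lemma starN x : star (- x) = - star x.
Proof. by apply: (addIr (star x)); rewrite -starD !addNr star0. Qed.

Lemma star1 : star (1 : A) = 1.
Proof.
by have := starM (star 1) (1 : A); rewrite mulr1 starK mulr1 => <-.
Qed.

Lemma cstar_normrM x y : `|x * y| <= `|x| * `|y|.
Proof. exact: cstar_normM. Qed.

Lemma norm_starM x : `|star x * x| = `|x| ^+ 2.
Proof. exact: cstar_norm_starM. Qed.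

(** The C*-identity and submultiplicativity give [|y|^2 <= |star y| |y|], hence
one inequality, which applied to [star y] is the other one. *)
Lemma norm_star x : `|star x| = `|x|.
Proof.
suff le y : `|y| <= `|star y|.
  by apply/eqP; rewrite eq_le le -{2}[x]starK le.
have [->|y0] := eqVneq y 0; first by rewrite star0.
rewrite -(ler_pM2r (_ : 0 < `|y|)) ?normr_gt0//.
by rewrite -expr2 -norm_starM cstar_normrM.
Qed.

End involution.

(** * Square roots of elements close to the unit *)

Section square_root.
Context {R : realType} {A : cstarAlgType R[i]}.
Implicit Types (x y z h : A) (r e : R[i]).

Lemma ge0_complexE r : 0 <= r -> r = (complex.Re r)%:C%C.
Proof. by move=> r0; rewrite RRe_real// ger0_real. Qed.

(** The inequalities force [r] and [e] to be real, which brings the claim back to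
geometric sequences over the archimedean field [R]. *)
Lemma expr_lt_eps r e : 0 <= r -> r < 1 -> 0 < e -> exists N, r ^+ N < e.
Proof.
move=> r0 r1 e0.
move: r0 r1 e0 (ge0_complexE _ r0) (ge0_complexE _ (ltW e0)).
move: (complex.Re r) (complex.Re e) => s d s0 s1 d0 rE eE; subst.
rewrite ltcR in d0; rewrite (_ : 1 = 1%:C%C)// ltcR in s1.
rewrite (_ : 0 = 0%:C%C)// lecR in s0.
have s1' : `|s| < 1 by rewrite ger0_norm.
have := cvg_expr s1' => /cvgrPdist_lt/(_ _ d0)/filter_ex[N].
rewrite sub0r normrN ger0_norm ?exprn_ge0// => lt; exists N.
by rewrite -rmorphXn ltcR.
Qed.

(** A fixed point [l] satisfies [2 l = h + l^2], that is [(1 - l)^2 = 1 - h]. *)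
Fixpoint sqrt_iter h n : A :=
  if n is n'.+1 then 2^-1 *: (h + sqrt_iter h n' * sqrt_iter h n') else 0.

Lemma norm_half x : `|2^-1 *: x| = 2^-1 * `|x|.
Proof. by rewrite normrZ ger0_norm// invr_ge0. Qed.

Section iteration.
Variables (h : A) (r : R[i]).
Hypotheses (r1 : r < 1) (hr : `|h| <= r).
Local Notation u := (sqrt_iter h).

Let r0 : 0 <= r. Proof. exact: le_trans hr. Qed.

Lemma norm_sqrt_iter n : `|u n| <= r.
Proof.
elim: n => [|n ih]; first by rewrite normr0.
rewrite /= norm_half mulrC ler_pdivrMr// mulr_natr mulr2n.
apply: (le_trans (ler_normD _ _)); apply: lerD => //.
apply: (le_trans (cstar_normrM _ _)).
apply: (@le_trans _ _ (r * r)); first exact: ler_pM.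
by rewrite -[leRHS]mulr1 ler_wpM2l// ltW.
Qed.

Lemma star_sqrt_iter n : star h = h -> star (u n) = u n.
Proof.
move=> sh; elim: n => [|n ih]; first exact: star0.
by rewrite /= starZ starD sh starM ih fmorphV rmorph_nat.
Qed.

(** On the ball of radius [r] the map [u |-> (h + u^2) / 2] is [r]-Lipschitz,
also for elements that do not commute:
[u^2 - v^2 = u (u - v) + (u - v) v]. *)
Lemma sqrt_iter_contract n : `|u n.+1 - u n| <= r ^+ n.+1.
Proof.
elim: n => [|n ih].
  rewrite /= mul0r addr0 subr0 norm_half expr1.
  apply: le_trans hr; rewrite -[leRHS]mul1r ler_wpM2r//.
  by rewrite invf_le1 ?ler1n.
have -> : u n.+2 - u n.+1 =
    2^-1 *: (u n.+1 * (u n.+1 - u n) + (u n.+1 - u n) * u n).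
  rewrite [u n.+2]/= {2}[u n.+1]/= -scalerBr; congr (_ *: _).
  rewrite opprD addrACA subrr add0r mulrBr mulrBl.
  by rewrite addrA subrK.
rewrite norm_half mulrC ler_pdivrMr// mulr_natr mulr2n.
apply: (le_trans (ler_normD _ _)); apply: lerD.
  apply: (le_trans (cstar_normrM _ _)); rewrite exprS.
  by apply: ler_pM => //; exact: norm_sqrt_iter.
apply: (le_trans (cstar_normrM _ _)); rewrite exprSr.
by apply: ler_pM => //; exact: norm_sqrt_iter.
Qed.

(** Tail of the geometric series of ratio [r]. *)
Lemma sqrt_iter_dist m n : `|u (m + n) - u m| <= r ^+ m / (1 - r).
Proof.
have r1' : 0 < 1 - r by rewrite subr_gt0.
rewrite ler_pdivlMr//.
(* The sharper bound is the partial geometric sum, which allows induction. *)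
suff : `|u (m + n) - u m| * (1 - r) <= r ^+ m * (1 - r ^+ n).
  move=> /le_trans; apply; rewrite -[leRHS]mulr1 ler_wpM2l ?exprn_ge0//.
  by rewrite gerBl exprn_ge0.
elim: n => [|n ih]; first by rewrite addn0 subrr normr0 mul0r expr0 subrr mulr0.
rewrite addnS -(subrK (u (m + n)) (u (m + n).+1)) -addrA.
have -> : r ^+ m * (1 - r ^+ n.+1) = r ^+ (m + n) * (1 - r) + r ^+ m * (1 - r ^+ n).
  by rewrite exprSr exprD !mulrBr !mulr1 mulrA [RHS]addrC addrA subrK.
have step : `|u (m + n).+1 - u (m + n)| * (1 - r) <= r ^+ (m + n) * (1 - r).
  rewrite ler_wpM2r ?(ltW r1')//; apply: (le_trans (sqrt_iter_contract _)).
  by rewrite exprSr -[leRHS]mulr1 ler_wpM2l ?exprn_ge0// ltW.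
apply: le_trans (lerD step ih).
by rewrite -mulrDl ler_wpM2r ?(ltW r1')// ler_normD.
Qed.

(** The conclusion bounds two consecutive terms, which is what is needed to
pass to the limit in the recursion of [sqrt_iter]. *)
Lemma sqrt_iter_cvg : exists l, forall e, 0 < e ->
  exists n, `|l - u n| < e /\ `|l - u n.+1| < e.
Proof.
have r1' : 0 < 1 - r by rewrite subr_gt0.
suff /cvg_ex[l /cvgrPdist_lt cl] : cvgn (u : nat -> A).
  by exists l => e /cl[N _ near_l]; exists N; split; apply: near_l => /=.
apply: cauchy_cvg; apply: cauchy_exP => e e0.
have [N ltN] := expr_lt_eps _ _ r0 r1 (mulr_gt0 e0 r1').
exists (u N), N => // n /= Nn; rewrite -ball_normE /=.
rewrite distrC -(subnKC Nn); apply: (le_lt_trans (sqrt_iter_dist _ _)).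
by rewrite ltr_pdivrMr.
Qed.

End iteration.

Lemma eps_eq x y (C : R[i]) : 0 <= C ->
  (forall e, 0 < e -> `|x - y| <= C * e) -> x = y.
Proof.
move=> C0 le_eps; apply/eqP; rewrite -subr_eq0 -normr_le0.
have C1 : 0 < C + 1 by rewrite ltr_wpDl.
apply/ler_addgt0Pl => e e0; rewrite addr0.
apply: (le_trans (le_eps _ (divr_gt0 e0 C1))).
by rewrite mulrCA ler_piMr ?(ltW e0)// ler_pdivrMr// mul1r lerDl.
Qed.

(** This makes [1 - h] visible to functionals that are positive on the elements
[star y * y]. *)
Lemma one_sub_square h : star h = h -> `|h| < 1 ->
  exists y, 1 - h = star y * y.
Proof.
move=> sh h1.
have [l cl] := sqrt_iter_cvg h _ h1 (lexx _).
(* The iterates are self-adjoint and the involution is an isometry. *)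
have sl : star l = l.
  apply: (@eps_eq _ _ 2) => // e /cl[n [/ltW le_n _]].
  rewrite -(subrK (sqrt_iter h n) (star l)) -addrA mulr_natl mulr2n.
  apply: (le_trans (ler_normD _ _)); apply: lerD; last by rewrite distrC.
  by rewrite -[X in _ - X](star_sqrt_iter h n sh) -starN -starD norm_star.
(* With [u] and [u'] consecutive iterates, [l - (h + l^2) / 2] is
   [(l - u') - (l (l - u) + (l - u) u) / 2], and [|u| <= |h|]. *)
have fl : l = 2^-1 *: (h + l * l).
  apply: (@eps_eq _ _ (1 + (`|l| + `|h|))) => [|e /cl[n [/ltW le_n /ltW le_n1]]].
    by rewrite !addr_ge0.
  rewrite -{1}(subrK (sqrt_iter h n.+1) l) -addrA [leRHS]mulrDl mul1r.
  apply: (le_trans (ler_normD _ _)); apply: lerD => //.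
  have -> : sqrt_iter h n.+1 - 2^-1 *: (h + l * l) =
     - (2^-1 *: (l * (l - sqrt_iter h n) + (l - sqrt_iter h n) * sqrt_iter h n)).
    rewrite /= -scalerBr -scalerN; congr (_ *: _).
    by rewrite opprD addrACA subrr add0r mulrBr mulrBl addrA subrK opprB.
  rewrite normrN norm_half mulrC ler_pdivrMr//.
  apply: (@le_trans _ _ ((`|l| + `|h|) * e)); last first.
    rewrite ler_peMr ?mulr_ge0 ?addr_ge0 ?ler1n//.
    exact: le_trans le_n.
  apply: (le_trans (ler_normD _ _)); rewrite [leRHS]mulrDl.
  apply: lerD; apply: (le_trans (cstar_normrM _ _)).
    by rewrite ler_wpM2l.
  rewrite mulrC; apply: ler_pM => //; exact: norm_sqrt_iter h1 _ _.
exists (1 - l).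
have h2 : h = l + l - l * l.
  apply: (addIr (l * l)); rewrite subrK -mulr2n -scaler_nat [in RHS]fl.
  by rewrite scalerA divff ?scale1r// pnatr_eq0.
rewrite starD starN star1 sl mulrBr mulr1 mulrBl mul1r {1}h2.
by rewrite !opprB opprD [X in 1 + X]addrCA !addrA.
Qed.

End square_root.

(** * Positive functionals and states *)

Section states.
Context {R : realType} {A : cstarAlgType R[i]}.
Local Notation normc := ComplexField.Normc.normc.
Implicit Types (x y z : A) (phi : {scalar A}).

Lemma functionalZ phi (c : R[i]) x : phi (c *: x) = c * phi x.
Proof. exact: linearZ. Qed.

Lemma functional_gram phi (c : R[i]) x y :
  phi (star (x + c *: y) * (x + c *: y)) =
  phi (star x * x) + c * phi (star x * y) + c^* * phi (star y * x)
  + c * c^* * phi (star y * y).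
Proof.
rewrite -!functionalZ -!linearD; congr (phi _).
rewrite starD starZ mulrDl !mulrDr -!scalerAl -!scalerAr scalerA addrA.
by rewrite (mulrC c^*).
Qed.

Section positive.
Variable phi : {scalar A}.
Hypothesis phi_pos : positive_functional phi.

(** Positivity at [x + c] makes [c phi (star x) + conj c * phi x] real for every
scalar [c]; the values [c = 1] and [c = 'i] determine [phi (star x)]. *)
Lemma positive_star x : phi (star x) = (phi x)^*.
Proof.
have real_cross c : c * phi (star x) + c^* * phi x =
    (c * phi (star x) + c^* * phi x)^*.
  have := phi_pos (x + c *: 1); rewrite functional_gram star1 !mulr1 mul1r => quad_ge0.
  have pp0 : 0 <= phi (star x * x) := phi_pos x.
  have p10 : 0 <= phi 1 by have := phi_pos 1; rewrite star1 mulr1.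
  have cc0 : 0 <= c * c^* * phi 1 by rewrite mulr_ge0// -normCK exprn_ge0.
  have -> : c * phi (star x) + c^* * phi x =
    (phi (star x * x) + c * phi (star x) + c^* * phi x + c * c^* * phi 1)
    - (phi (star x * x) + c * c^* * phi 1).
    by rewrite -!addrA; ring.
  by rewrite rmorphB/= (geC0_conj quad_ge0) (geC0_conj (addr_ge0 pp0 cc0)).
move: (real_cross 1) (real_cross 'i); rewrite !rmorphD !rmorphM/= !conjCK.
rewrite conjC1 conjCi !mul1r => eq1 eqi.
move: eqi; rewrite !mulNr [in RHS]addrC -!mulrBr => /(mulfI (neq0Ci _)) eq2.
apply: (@mulIf _ 2); rewrite ?pnatr_eq0//.
have -> : phi (star x) * 2 = (phi (star x) + phi x) + (phi (star x) - phi x).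
  by ring.
by rewrite eq1 eq2; ring.
Qed.

Lemma positive_hermitian x y : phi (star x * y) = (phi (star y * x))^*.
Proof. by rewrite -positive_star starM starK. Qed.

(** Positivity at [x - (phi (star y * x) / q) y]. An upper bound [q > 0] takes
the place of [phi (star y * y)], which avoids dividing by zero when the form
is degenerate at [y]. *)
Lemma positive_cauchy_schwarz_le x y (q : R[i]) :
  0 < q -> phi (star y * y) <= q ->
  `|phi (star y * x)| ^+ 2 <= phi (star x * x) * q.
Proof.
move=> q0 yq; set c := phi (star y * x).
have := phi_pos (x + (- (c / q)) *: y).
rewrite functional_gram (positive_hermitian x y) -/c rmorphN/= fmorph_div/=.
rewrite (geC0_conj (ltW q0)).
rewrite mulrNN !mulNr.
have -> : c / q * c^* = `|c| ^+ 2 / q by rewrite normCK mulrAC.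
have -> : c^* / q * c = `|c| ^+ 2 / q by rewrite normCK mulrAC (mulrC c).
have -> : c / q * (c^* / q) = `|c| ^+ 2 / q / q.
  by rewrite normCK mulrACA !mulrA.
move=> quad_ge0; rewrite -ler_pdivrMr// -subr_ge0; apply: le_trans quad_ge0 _.
rewrite -addrA -addrA lerD2l// -[leRHS]addr0 lerD2l addrC subr_le0.
by rewrite mulrAC ler_pdivrMr// ler_wpM2l// mulr_ge0 ?exprn_ge0// invr_ge0 ltW.
Qed.

End positive.

Section state.
Variable phi : {scalar A}.
Hypothesis phi_state : state_space phi.
Let phi_pos : positive_functional phi. Proof. by case: phi_state. Qed.
Let phi1 : phi 1 = 1. Proof. by case: phi_state. Qed.

(** For [s > |x|^2], the element [1 - star x * x / s] is of the form
[star y * y], so [phi (star x * x) <= s]. *)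
Lemma state_le_sqr_norm x : phi (star x * x) <= `|x| ^+ 2.
Proof.
apply/ler_addgt0Pl => e e0; set s := e + _.
have s0 : 0 < s by rewrite ltr_wpDr// exprn_ge0.
have [|| y xE] := @one_sub_square _ _ (s^-1 *: (star x * x)).
- by rewrite starZ starM starK fmorphV/= (geC0_conj (ltW s0)).
- rewrite normrZ normfV (gtr0_norm s0) norm_starM mulrC ltr_pdivrMr// mul1r.
  by rewrite ltrDr.
have := phi_pos y; rewrite -xE linearB linearZ/= phi1 subr_ge0.
by rewrite mulrC ler_pdivrMr// mul1r.
Qed.

Lemma state_cauchy_schwarz x y :
  `|phi (star y * x)| ^+ 2 <= phi (star x * x) * `|y| ^+ 2.
Proof.
have [->|y0] := eqVneq y 0.
  by rewrite star0 mul0r linear0 !normr0 !expr0n/= mulr0.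
apply: positive_cauchy_schwarz_le => //; last exact: state_le_sqr_norm.
by rewrite exprn_gt0// normr_gt0.
Qed.

Lemma state_sqr_le x : `|phi x| ^+ 2 <= phi (star x * x).
Proof.
have := @positive_cauchy_schwarz_le _ phi_pos x 1 1 ltr01.
by rewrite star1 !mul1r mulr1 phi1; apply.
Qed.

Lemma state_norm_le x : `|phi x| <= `|x|.
Proof.
rewrite -(@ler_pXn2r _ 2) ?nnegrE//.
exact: le_trans (state_sqr_le x) (state_le_sqr_norm x).
Qed.

(** Buzano's inequality: the square length of [z = x - alpha (phi x) 1] is
[phi (star x * x) + (|alpha - 1|^2 - 1) |phi x|^2], at most
[M^2 phi (star x * x)], and [phi (y * z) = phi (y * x) - alpha phi x phi y]
is estimated by the Cauchy-Schwarz inequality. *)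
Lemma state_buzano (alpha M : R[i]) x y : 1 <= M -> `|alpha - 1| <= M ->
  `|alpha| * (`|phi x| * `|phi y|) <= M * (`|x| * `|y|) + `|phi (y * x)|.
Proof.
move=> M1 alphaM; have M0 : 0 <= M by apply: le_trans M1.
set c := - (alpha * phi x); set z := x + c *: 1.
have zE : phi (star z * z) <= M ^+ 2 * phi (star x * x).
  have -> : phi (star z * z) =
      phi (star x * x) + (`|alpha - 1| ^+ 2 - 1) * `|phi x| ^+ 2.
    rewrite functional_gram star1 !mulr1 mul1r phi1 (positive_star _ phi_pos).
    rewrite /c !normCK rmorphN rmorphM rmorphB/= conjC1.
    by ring.
  apply: (@le_trans _ _ (phi (star x * x) + (M ^+ 2 - 1) * `|phi x| ^+ 2)).
    by rewrite lerD2l ler_wpM2r ?exprn_ge0// lerD2r ler_pXn2r ?nnegrE.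
  rewrite -lerBrDl -{2}[phi (star x * x)]mul1r -mulrBl ler_wpM2l ?state_sqr_le//.
  by rewrite subr_ge0 exprn_ege1.
have zy : `|phi (y * z)| <= M * (`|x| * `|y|).
  rewrite -(@ler_pXn2r _ 2) ?nnegrE ?mulr_ge0//.
  have := state_cauchy_schwarz z (star y); rewrite starK norm_star.
  move=> /le_trans; apply; rewrite !exprMn mulrA ler_wpM2r ?exprn_ge0//.
  apply: (le_trans zE); rewrite ler_wpM2l ?exprn_ge0//.
  exact: state_le_sqr_norm.
apply: le_trans (lerD zy (lexx _)).
rewrite -!normrM -[`|phi (y * z)|]normrN; apply: le_trans (ler_normD _ _).
rewrite /z mulrDr linearD -scalerAr functionalZ mulr1 opprD addrAC addNr add0r.
by rewrite /c mulNr opprK mulrA.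
Qed.

End state.

(** * Real-valued norms and the numerical radius *)

Lemma normc_complexE (z : R[i]) : (normc z)%:C%C = `|z|.
Proof. by rewrite normc_def; case: z. Qed.

Lemma normc_ge0 (z : R[i]) : 0 <= normc z.
Proof. by rewrite -ler0c normc_complexE. Qed.

Lemma cstar_norm_complexE x : (cstar_norm x)%:C%C = `|x|.
Proof. by rewrite -ge0_complexE. Qed.

Lemma cstar_norm_ge0 x : 0 <= cstar_norm x.
Proof. by rewrite -ler0c cstar_norm_complexE. Qed.

Lemma numerical_radius_ge phi x : state_space phi ->
  normc (phi x) <= numerical_radius x.
Proof.
move=> phi_state; apply: ub_le_sup; last by exists phi.
exists (cstar_norm x) => _ [psi psi_state <-].
by rewrite -lecR normc_complexE cstar_norm_complexE state_norm_le.
Qed.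

Lemma numerical_radius_ge0 x : 0 <= numerical_radius x.
Proof.
have [[phi phi_state]|/set0P/negP] := pselect ((@state_space R A) !=set0)%classic.
  exact: le_trans (normc_ge0 _) (numerical_radius_ge _ x phi_state).
rewrite negbK => /eqP empty.
by rewrite /numerical_radius empty image_set0 sup0.
Qed.

(** The bound passes to the supremum through the cube root of [b]. On an empty
set of states the supremum is 0, which is the case that [0 <= b] covers. *)
Lemma numerical_radius_exp3_le x (b : R) : 0 <= b ->
  (forall phi, state_space phi -> normc (phi x) ^+ 3 <= b) ->
  numerical_radius x ^+ 3 <= b.
Proof.
move=> b0 le_b.
have [[phi phi_state]|/set0P/negP] := pselect ((@state_space R A) !=set0)%classic.
  have rootK : (b `^ 3^-1) ^+ 3 = b.
    by rewrite -powR_mulrn ?powR_ge0// -powRrM mulVf ?powRr1// pnatr_eq0.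
  rewrite -[leRHS]rootK ler_pXn2r ?nnegrE ?powR_ge0 ?numerical_radius_ge0//.
  apply: ge_sup; first by exists (normc (phi x)), phi.
  move=> _ [psi psi_state <-].
  rewrite -(@ler_pXn2r _ 3) ?nnegrE ?powR_ge0 ?normc_ge0//.
  by rewrite rootK le_b.
rewrite negbK => /eqP empty.
by rewrite /numerical_radius empty image_set0 sup0 expr0n.
Qed.

Lemma state_buzano_real phi (alpha : R[i]) x y : state_space phi ->
  normc alpha * (normc (phi x) * normc (phi y)) <=
  Num.max 1 (normc (alpha - 1)) *
    (cstar_norm x * cstar_norm y) + normc (phi (y * x)).
Proof.
move=> phi_state; set M := Num.max _ _.
have M1 : 1 <= M%:C%C by rewrite (_ : 1 = 1%:C%C)// lecR le_max lexx.
have Malpha : `|alpha - 1| <= M%:C%C.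
  by rewrite -normc_complexE lecR le_max lexx orbT.
have := state_buzano _ phi_state _ _ x y M1 Malpha.
rewrite -!normc_complexE -!cstar_norm_complexE.
by rewrite -!rmorphM -rmorphD lecR.
Qed.

Lemma state_sqr_le_real phi x : state_space phi ->
  normc (phi x) ^+ 2 <= normc (phi (star x * x)).
Proof.
move=> phi_state; rewrite -lecR rmorphXn/= !normc_complexE.
apply: le_trans (state_sqr_le _ phi_state x) _.
by rewrite ger0_norm//; case: phi_state => + _; apply.
Qed.

Lemma normc_state_star phi x : state_space phi ->
  normc (phi (star x)) = normc (phi x).
Proof.
case=> phi_pos _; apply: complexI.
by rewrite !normc_complexE positive_star// norm_conjC.
Qed.

Lemma cstar_norm_star x : cstar_norm (star x) = cstar_norm x.
Proof. by rewrite /cstar_norm norm_star. Qed.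

Lemma cstar_norm_starM x : cstar_norm (star x * x) = cstar_norm x ^+ 2.
Proof.
apply: complexI; rewrite rmorphXn/=.
by rewrite !cstar_norm_complexE norm_starM.
Qed.

(** One factor [phi x] is kept and the other two are absorbed by
[|phi x|^2 <= phi (star x * x)], respectively
[|phi x|^2 <= phi (x * star x)], before the Buzano inequality is used. *)
Lemma state_cube_le phi (alpha : R[i]) x : state_space phi ->
  normc alpha * normc (phi x) ^+ 3 <=
  Num.max 1 (normc (alpha - 1)) * cstar_norm x ^+ 3 +
  Num.min (numerical_radius (star x * x ^+ 2))
          (numerical_radius (x ^+ 2 * star x)).
Proof.
move=> phi_state; rewrite -lerBlDl le_min !lerBlDl; apply/andP; split.
- apply: le_trans (lerD (lexx _) (numerical_radius_ge _ _ phi_state)).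
  have := state_buzano_real _ alpha x (star x * x) phi_state.
  rewrite cstar_norm_starM -exprS -(mulrA (star x)) -expr2; apply: le_trans.
  by rewrite ler_wpM2l ?normc_ge0// exprS ler_wpM2l ?normc_ge0// state_sqr_le_real.
- apply: le_trans (lerD (lexx _) (numerical_radius_ge _ _ phi_state)).
  have := state_buzano_real _ alpha (star (star x) * star x) x phi_state.
  rewrite cstar_norm_starM cstar_norm_star -exprSr starK (mulrA x) -expr2.
  apply: le_trans; rewrite ler_wpM2l ?normc_ge0// exprSr ler_wpM2r ?normc_ge0//.
  have := state_sqr_le_real _ (star x) phi_state.
  by rewrite normc_state_star// starK.
Qed.

End states.

Theorem theorem2p16 (R : realType) (A : cstarAlgType R[i]) (a : A)
    (alpha : R[i]) (halpha : alpha != 0) :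
  numerical_radius a ^+ 3 <=
    (ComplexField.Normc.normc alpha)^-1 *
      (Num.max 1 (ComplexField.Normc.normc (alpha - 1)) * cstar_norm a ^+ 3 +
       Num.min (numerical_radius (star a * a ^+ 2))
               (numerical_radius (a ^+ 2 * star a))).
Proof.
have alpha_gt0 : 0 < ComplexField.Normc.normc alpha.
  by rewrite -ltcR normc_complexE normr_gt0.
apply: numerical_radius_exp3_le => [|phi phi_state].
  rewrite mulr_ge0 ?invr_ge0 ?(ltW alpha_gt0)// addr_ge0//.
    by rewrite mulr_ge0 ?exprn_ge0 ?cstar_norm_ge0// le_max ler01.
  by rewrite le_min !numerical_radius_ge0.
by rewrite ler_pdivlMl// state_cube_le.
Qed.
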